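(* Let $\alpha\neq0$ be a real number. Any rotational (spacelike) $K^\alpha$-translator with lightlike axis, normalized so that the axis is spanned by $(0,1,1)$ and the speed is $\vec v=(0,-1,-1)$, is parametrized by $X(r,t)=(2rt,\,f(r)+r-rt^2,\,f(r)-r-rt^2)$, where $$f(r)=\begin{cases} m\displaystyle\int^r e^{4t^2}\,dt,\quad m>0, & \alpha=\frac12,\\[2mm] \displaystyle\int^r\Big(\frac{2(1-2\alpha)}{\alpha}t^2+m\Big)^{\frac{2\alpha}{1-2\alpha}}dt,\quad m\in\mathbb R, & \alpha\neq\frac12.\end{cases}$$ The maximal domain of the function $f(r)$ is: 1. Case $\alpha=1/2$: $(0,\infty)$. 2. Case $\alpha\in(0,1/2)$: $(0,\infty)$ if $m\ge0$, or $\Big(\sqrt{\frac{\alpha}{2(2\alpha-1)}m},\infty\Big)$ if $m<0$. 3. Case $\alpha\notin[0,1/2]$: $\Big(0,\sqrt{\frac{\alpha}{2(2\alpha-1)}m}\Big)$, where $m>0$.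
   Context: $\mathbb R_1^3$ is $\mathbb R^3$ with the metric $\langle,\rangle=dx^2+dy^2-dz^2$. A surface is spacelike if its induced metric is Riemannian; then its unit normal $N$ satisfies $\langle N,N\rangle=\epsilon=-1$. The Gauss curvature is $K=\epsilon\det(A)$, where $AU=-\nabla^0_U N$ is the Weingarten map and $\nabla^0$ is the Levi-Civita connection of $\mathbb R_1^3$. In a local parametrization $X(u,v)$, $$K=-\frac{\det(X_u,X_v,X_{uu})\det(X_u,X_v,X_{vv})-\det(X_u,X_v,X_{uv})^2}{(EG-F^2)^2},$$ where $E=\langle X_u,X_u\rangle$, $F=\langle X_u,X_v\rangle$, $G=\langle X_v,X_v\rangle$. A spacelike surface is a $K^\alpha$-translator with speed $\vec v$ if $K>0$ and $K^\alpha=\langle N,\vec v\rangle$ everywhere, for a choice of unit normal $N$. A surface of revolution with axis spanned by $(0,1,1)$ is one parametrized by $X(r,t)=(2rt,\,f(r)+r-rt^2,\,f(r)-r-rt^2)$ with $f$ smooth on an interval of $r>0$; it is spacelike iff $f'>0$. The symbol $\int^r$ denotes an antiderivative (defined up to an additive constant), and $m$ is a constant of integration. The maximal domain of $f$ is the largest open interval in $(0,\infty)$ on which the formula defines a smooth function for which $X$ is spacelike with $K>0$ and satisfies the translator equation; only the values of $m$ listed give a nonempty domain. *)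

(* Defs.v *)
From Stdlib Require Import Reals.
From Coquelicot Require Export Coquelicot.
Open Scope R_scope.

Definition R3 : Type := (R * R * R)%type.

Definition cx (p : R3) : R := fst (fst p).
Definition cy (p : R3) : R := snd (fst p).
Definition cz (p : R3) : R := snd p.

Definition lorentz (p q : R3) : R := cx p * cx q + cy p * cy q - cz p * cz q.

Definition lincomb (a : R) (p : R3) (b : R) (q : R3) : R3 :=
  (a * cx p + b * cx q, a * cy p + b * cy q, a * cz p + b * cz q).

(* Surfaces are given by a parametrization X u v, where (u, v) ranges over a
   set U.  As the metric of R^3_1 has constant coefficients, its Levi-Civita
   connection is coordinatewise differentiation, so nabla^0 of a field along X
   in the direction X_u (resp. X_v) is dU (resp. dV) of that field. *)
Definition dU (X : R -> R -> R3) (u v : R) : R3 :=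
  (Derive (fun s => cx (X s v)) u,
   Derive (fun s => cy (X s v)) u,
   Derive (fun s => cz (X s v)) u).

Definition dV (X : R -> R -> R3) (u v : R) : R3 :=
  (Derive (fun s => cx (X u s)) v,
   Derive (fun s => cy (X u s)) v,
   Derive (fun s => cz (X u s)) v).

Definition differentiable_on (U : R -> R -> Prop) (X : R -> R -> R3) : Prop :=
  forall u v, U u v ->
    differentiable_pt (fun s t => cx (X s t)) u v /\
    differentiable_pt (fun s t => cy (X s t)) u v /\
    differentiable_pt (fun s t => cz (X s t)) u v.

(* The induced metric is positive definite; in particular X_u and X_v are
   linearly independent, as a vanishing combination has zero square. *)
Definition spacelike (U : R -> R -> Prop) (X : R -> R -> R3) : Prop :=
  forall u v, U u v -> forall a b : R, (a, b) <> (0, 0) ->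
    let w := lincomb a (dU X u v) b (dV X u v) in 0 < lorentz w w.

(* On a connected spacelike surface a differentiable (hence continuous) unit
   normal field is one of the two smooth ones. *)
Definition unit_normal (U : R -> R -> Prop) (X N : R -> R -> R3) : Prop :=
  differentiable_on U N /\
  forall u v, U u v ->
    lorentz (N u v) (N u v) = -1 /\
    lorentz (N u v) (dU X u v) = 0 /\
    lorentz (N u v) (dV X u v) = 0.

(* [[a, b], [c, d]] is the matrix in the basis (X_u, X_v) of the Weingarten
   map A W = - nabla^0_W N:  A X_u = a X_u + c X_v and A X_v = b X_u + d X_v. *)
Definition weingarten (X N : R -> R -> R3) (u v a b c d : R) : Prop :=
  lincomb (-1) (dU N u v) 0 (dU N u v) = lincomb a (dU X u v) c (dV X u v) /\
  lincomb (-1) (dV N u v) 0 (dV N u v) = lincomb b (dU X u v) d (dV X u v).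

(* K = epsilon * det A with epsilon = <N, N> = -1. *)
Definition gauss_curvature (X N : R -> R -> R3) (u v K : R) : Prop :=
  exists a b c d : R, weingarten X N u v a b c d /\ K = -1 * (a * d - b * c).

Definition spacelike_translator (alpha : R) (speed : R3)
    (U : R -> R -> Prop) (X : R -> R -> R3) : Prop :=
  differentiable_on U X /\ spacelike U X /\
  exists N : R -> R -> R3, unit_normal U X N /\
    forall u v, U u v ->
      exists K : R, gauss_curvature X N u v K /\ 0 < K /\
        Rpower K alpha = lorentz (N u v) speed.

Definition ointv (a b : Rbar) (r : R) : Prop := Rbar_lt a r /\ Rbar_lt r b.

Definition smooth_on (a b : Rbar) (f : R -> R) : Prop :=
  forall (n : nat) (r : R), ointv a b r -> ex_derive_n f n r.

(* Surface of revolution with axis spanned by (0,1,1). *)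
Definition rot_surface (f : R -> R) (r t : R) : R3 :=
  (2 * r * t, f r + r - r * t ^ 2, f r - r - r * t ^ 2).

(* f generates, over the nonempty open interval (a, b) of (0, oo), a spacelike
   rotational K^alpha-translator with speed (0,-1,-1); t ranges over R. *)
Definition rot_translator (alpha : R) (a b : Rbar) (f : R -> R) : Prop :=
  Rbar_le 0 a /\ Rbar_lt a b /\ smooth_on a b f /\
  spacelike_translator alpha (0, -1, -1)
    (fun r _ : R => ointv a b r) (rot_surface f).

(* y is the value of x^e.  Rpower is a power only for a positive base.  Integer
   exponents are also given their usual meaning for a negative base: for
   alpha = 1/3 the formula for f' is (2 t^2 + m)^2, which makes sense for every
   t, and it is K > 0 that rules out the points where the base is negative. *)
Definition is_power (x e y : R) : Prop :=
  (0 < x /\ y = Rpower x e) \/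
  (x = 0 /\ 0 < e /\ y = 0) \/
  (exists n : Z, e = IZR n /\ x <> 0 /\ y = powerRZ x n).

Definition is_integrand (alpha m t y : R) : Prop :=
  (alpha = 1 / 2 /\ y = m * exp (4 * t ^ 2)) \/
  (alpha <> 1 / 2 /\
   is_power (2 * (1 - 2 * alpha) / alpha * t ^ 2 + m)
            (2 * alpha / (1 - 2 * alpha)) y).

(* f is given on (a, b) by the indefinite integral of the integrand. *)
Definition is_profile (alpha m : R) (a b : Rbar) (f : R -> R) : Prop :=
  forall r, ointv a b r ->
    exists y, is_integrand alpha m r y /\ is_derive f r y.

(* The formula makes sense on (a, b) and all the functions it defines there
   (they differ by constants) generate translators. *)
Definition admissible (alpha m : R) (a b : Rbar) : Prop :=
  (exists f, is_profile alpha m a b f) /\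
  (forall f, is_profile alpha m a b f -> rot_translator alpha a b f).

Definition maximal_domain (alpha m : R) (a b : Rbar) : Prop :=
  admissible alpha m a b /\
  forall a' b', admissible alpha m a' b' ->
    forall r, ointv a' b' r -> ointv a b r.

Definition empty_domain (alpha m : R) : Prop :=
  forall a b, ~ admissible alpha m a b.

(* Main.v *)
(* For X(r,t) one has E = 4 f', F = 0, G = 4 r^2, the unit normal with
   <N, v> > 0 has <N, v> = f'^(-1/2), and X_r, X_t are principal directions with
   K = f'' / (8 r f'^2).  The translator equation is thus the first-order ODE
   g' = 8 r g^(2 - 1/(2 alpha)) for g = f' > 0, with first integral
   g exp(-4 r^2) if alpha = 1/2, and g^b - 4 b r^2 with
   b = (1 - 2 alpha)/(2 alpha) otherwise.  Conversely the solutions are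
   admissible exactly where the base of the power is positive. *)
Require Import Defs.
From Stdlib Require Import Reals Lra.
From Coquelicot Require Import Coquelicot.
Open Scope R_scope.

(** * Calculus on open intervals: real powers, primitives, smoothness *)

Lemma Rpower_pos (x y : R) : 0 < Rpower x y.
Proof. apply exp_pos. Qed.

Lemma is_derive_Rpower (u : R -> R) (e r du : R) :
  0 < u r -> is_derive u r du ->
  is_derive (fun t => Rpower (u t) e) r (e * Rpower (u r) (e - 1) * du).
Proof.
  intros Hu Hd.
  replace (e * Rpower (u r) (e - 1) * du)
    with (scal du (e * Rpower (u r) (e - 1))) by (cbn; unfold mult; cbn; ring).
  apply (is_derive_comp (fun x => Rpower x e) u); [|exact Hd].
  apply is_derive_Reals, derivable_pt_lim_power, Hu.
Qed.

(** With [x = f'] this is the normalization [<N, N> = -1] of the normal whose component [p] is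
    [- f'^(-1/2)]. *)
Lemma Rpower_half_neg_sqr (x : R) :
  0 < x -> x * (Rpower x (- / 2) * Rpower x (- / 2)) = 1.
Proof.
  intros Hx. rewrite <- Rpower_plus.
  replace (- / 2 + - / 2) with (- (1)) by field.
  rewrite Rpower_Ropp, Rpower_1 by lra. field. lra.
Qed.

Lemma ointv_open (a b : Rbar) : open (ointv a b).
Proof. apply open_and; [apply open_Rbar_gt | apply open_Rbar_lt]. Qed.

Lemma ointv_nonempty (a b : Rbar) : Rbar_lt a b -> exists r, ointv a b r.
Proof.
  unfold ointv.
  destruct a as [a| |], b as [b| |]; cbn; intros H; try easy.
  - exists ((a + b) / 2). lra.
  - exists (a + 1). split; [lra | easy].
  - exists (b - 1). split; [easy | lra].
  - now exists 0.
Qed.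

Lemma ointv_between (a b : Rbar) (x y z : R) :
  ointv a b x -> ointv a b y -> x <= z <= y -> ointv a b z.
Proof.
  unfold ointv.
  destruct a as [a| |], b as [b| |]; cbn; intros; intuition lra.
Qed.

Lemma ointv_pos (a b : Rbar) (r : R) : Rbar_le 0 a -> ointv a b r -> 0 < r.
Proof. unfold ointv; destruct a as [a| |]; cbn; intros; intuition lra. Qed.

Lemma derive_zero_constant (a b : Rbar) (h : R -> R) :
  (forall r, ointv a b r -> is_derive h r 0) ->
  forall x y, ointv a b x -> ointv a b y -> h x = h y.
Proof.
  intros Hh.
  assert (Hlt : forall x y, ointv a b x -> ointv a b y -> x < y -> h x = h y).
  { intros x y Hx Hy Hxy. apply (eq_is_derive h x y); [|exact Hxy].
    intros t Ht. apply Hh. now apply (ointv_between a b x y). }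
  intros x y Hx Hy. destruct (Rtotal_order x y) as [H|[H|H]].
  - now apply Hlt.
  - now subst.
  - symmetry. now apply Hlt.
Qed.

(** The endpoints may be infinite or singular for [g], so the integral starts at an interior
    point. *)
Lemma exists_primitive (a b : Rbar) (g : R -> R) :
  Rbar_lt a b -> (forall r, ointv a b r -> continuous g r) ->
  exists f, forall r, ointv a b r -> is_derive f r (g r).
Proof.
  intros Hab Hg. destruct (ointv_nonempty a b Hab) as [r0 Hr0].
  exists (fun x => RInt g r0 x). intros r Hr.
  apply is_derive_RInt with (a := r0); [|now apply Hg].
  generalize (ointv_open a b r Hr). apply filter_imp. intros x Hx.
  apply (RInt_correct g r0 x), (ex_RInt_continuous g). intros z Hz. apply Hg.
  destruct (Rle_dec r0 x) as [H|H].
  - rewrite Rmin_left, Rmax_right in Hz by lra.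
    now apply (ointv_between a b r0 x).
  - rewrite Rmin_right, Rmax_left in Hz by lra.
    now apply (ointv_between a b x r0).
Qed.

(* A class of functions closed under differentiation, which contains the
   integrands of both cases of the theorem and their primitives. *)
Inductive elementary (D : R -> Prop) : (R -> R) -> Prop :=
| elem_const c : elementary D (fun _ => c)
| elem_id : elementary D (fun x => x)
| elem_plus u v : elementary D u -> elementary D v ->
    elementary D (fun x => u x + v x)
| elem_mult u v : elementary D u -> elementary D v ->
    elementary D (fun x => u x * v x)
| elem_exp u : elementary D u -> elementary D (fun x => exp (u x))
| elem_Rpower u e : elementary D u -> (forall x, D x -> 0 < u x) ->
    elementary D (fun x => Rpower (u x) e)
| elem_primitive f g : (forall x, D x -> is_derive f x (g x)) ->
    elementary D g -> elementary D f.

Lemma elementary_derive (D : R -> Prop) (f : R -> R) :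
  elementary D f ->
  exists g, elementary D g /\ forall x, D x -> is_derive f x (g x).
Proof.
  induction 1 as [c| |u v Hu [u' [Eu Du]] Hv [v' [Ev Dv]]
                 |u v Hu [u' [Eu Du]] Hv [v' [Ev Dv]]
                 |u Hu [u' [Eu Du]]|u e Hu [u' [Eu Du]] Hpos|f g Hf Hg _].
  - exists (fun _ => 0). split; [constructor|].
    intros x _. apply is_derive_Reals, derivable_pt_lim_const.
  - exists (fun _ => 1). split; [constructor|].
    intros x _. apply is_derive_Reals, derivable_pt_lim_id.
  - exists (fun x => u' x + v' x). split; [now constructor|].
    intros x Hx. apply (is_derive_plus u v); auto.
  - exists (fun x => u' x * v x + u x * v' x).
    split; [now apply elem_plus; apply elem_mult|].
    intros x Hx. apply (is_derive_mult u v); auto. exact Rmult_comm.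
  - exists (fun x => u' x * exp (u x)).
    split; [now apply elem_mult, elem_exp|].
    intros x Hx. apply (is_derive_comp exp u); auto. apply is_derive_exp.
  - exists (fun x => e * Rpower (u x) (e - 1) * u' x).
    split; [now repeat apply elem_mult; [apply elem_const | apply elem_Rpower |]|].
    intros x Hx. apply is_derive_Rpower; auto.
  - now exists g.
Qed.

(** By induction every iterated derivative agrees on the interval with an elementary function.
    Agreement on an open set is enough to differentiate once more. *)
Lemma elementary_smooth (a b : Rbar) (f : R -> R) :
  elementary (ointv a b) f -> smooth_on a b f.
Proof.
  intros Hf.
  assert (H : forall n, exists g, elementary (ointv a b) g /\
            forall x, ointv a b x -> Derive_n f n x = g x).
  { induction n as [|n [g [Hg E]]].
    - now exists f.
    - destruct (elementary_derive _ g Hg) as [g' [Hg' D]].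
      exists g'. split; [exact Hg'|]. intros x Hx.
      rewrite <- (is_derive_unique g x (g' x)) by auto.
      apply Derive_ext_loc. generalize (ointv_open a b x Hx).
      now apply filter_imp. }
  (* [ex_derive_n f 0] is [True] by definition; order [n + 1] asks for a derivative of
     [Derive_n f n]. *)
  intros [|n] x Hx; [exact I|].
  destruct (H n) as [g [Hg E]].
  destruct (elementary_derive _ g Hg) as [g' [_ D]].
  exists (g' x). apply (is_derive_ext_loc g); [|now apply D].
  generalize (ointv_open a b x Hx). apply filter_imp. intros; symmetry; auto.
Qed.

(** * Differentiability in two variables *)

(** The error of the linear approximation is exactly [(u - x) * (v - y)], so [delta = eps] works. *)
Lemma differentiable_pt_lim_mult (x y : R) :
  differentiable_pt_lim Rmult x y y x.
Proof.
  intros eps. exists eps. intros u v Hu Hv.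
  replace (u * v - x * y - (y * (u - x) + x * (v - y)))
    with ((u - x) * (v - y)) by ring.
  rewrite Rabs_mult. apply Rmult_le_compat; try apply Rabs_pos.
  - now left.
  - apply Rmax_r.
Qed.

Lemma differentiable_pt_lim_linear (k l x y : R) :
  differentiable_pt_lim (fun u v => k * u + l * v) x y k l.
Proof.
  intros eps. exists eps. intros u v _ _.
  replace (k * u + l * v - (k * x + l * y) - (k * (u - x) + l * (v - y)))
    with 0 by ring.
  rewrite Rabs_R0. apply Rmult_le_pos; [apply Rlt_le, eps|].
  apply Rle_trans with (Rabs (u - x)); [apply Rabs_pos | apply Rmax_l].
Qed.

(** Every coordinate of the surface and of its normal is a sum of two products of a function of [r]
    and a function of [t]; this reduces their differentiability to one variable. *)
Lemma differentiable_pt_separable (h : R -> R -> R) (u1 u2 w1 w2 : R -> R)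
    (x y : R) :
  (forall s t, h s t = u1 s * w1 t + u2 s * w2 t) ->
  ex_derive u1 x -> ex_derive u2 x -> ex_derive w1 y -> ex_derive w2 y ->
  differentiable_pt h x y.
Proof.
  intros E [du1 Hu1] [du2 Hu2] [dw1 Hw1] [dw2 Hw2].
  assert (P : forall u w du dw, is_derive u x du -> is_derive w y dw ->
            exists k l, differentiable_pt_lim (fun s t => u s * w t) x y k l).
  { intros u w du dw Hu Hw. eexists. eexists.
    apply (differentiable_pt_lim_comp Rmult (fun s _ => u s) (fun _ t => w t)).
    - apply differentiable_pt_lim_mult.
    - apply differentiable_pt_lim_proj1_0, is_derive_Reals, Hu.
    (* Writing [t] as [0 * s + 1 * t] makes [w t] a function of a first variable composed with a
       linear map. *)
    - apply (differentiable_pt_lim_ext (fun s t => w (0 * s + 1 * t))).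
      { exists (mkposreal 1 Rlt_0_1). intros s t _ _. f_equal. ring. }
      apply (differentiable_pt_lim_comp (fun a _ => w a)
               (fun s t => 0 * s + 1 * t) (fun s t => 0 * s + 0 * t)).
      + apply differentiable_pt_lim_proj1_0, is_derive_Reals.
        replace (0 * x + 1 * y) with y by ring. exact Hw.
      + apply differentiable_pt_lim_linear.
      + apply differentiable_pt_lim_linear. }
  destruct (P u1 w1 du1 dw1) as [k1 [l1 H1]]; auto.
  destruct (P u2 w2 du2 dw2) as [k2 [l2 H2]]; auto.
  exists (1 * k1 + 1 * k2), (1 * l1 + 1 * l2).
  apply (differentiable_pt_lim_ext
           (fun s t => 1 * (u1 s * w1 t) + 1 * (u2 s * w2 t))).
  { exists (mkposreal 1 Rlt_0_1). intros s t _ _. rewrite E. ring. }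
  apply (differentiable_pt_lim_comp (fun p q => 1 * p + 1 * q)
           (fun s t => u1 s * w1 t) (fun s t => u2 s * w2 t)); auto.
  apply differentiable_pt_lim_linear.
Qed.

(** * Tangent vectors, normal and curvature of the rotational surface *)

Lemma dU_rot_surface (f : R -> R) (r t g : R) :
  is_derive f r g ->
  dU (rot_surface f) r t = (2 * t, g + 1 - t ^ 2, g - 1 - t ^ 2).
Proof.
  intros Hf. assert (Ef : ex_derive f r) by now exists g.
  apply is_derive_unique in Hf as Df.
  unfold dU, rot_surface, cx, cy, cz; cbn [fst snd].
  f_equal; [f_equal|]; apply is_derive_unique; auto_derive; trivial;
    change (fun x => f x) with f; rewrite ?Df; ring.
Qed.

Lemma dV_rot_surface (f : R -> R) (r t : R) :
  dV (rot_surface f) r t = (2 * r, - 2 * r * t, - 2 * r * t).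
Proof.
  unfold dV, rot_surface, cx, cy, cz; cbn [fst snd].
  f_equal; [f_equal|]; apply is_derive_unique; auto_derive; trivial; ring.
Qed.

(* The vectors orthogonal to both tangent vectors, where g = f' and
   p = <N, (0, 1, 1)>. *)
Definition rot_normal (g p : R -> R) (r t : R) : R3 :=
  (t * p r, (p r - (g r + t ^ 2) * p r) / 2, (- p r - (g r + t ^ 2) * p r) / 2).

(** The normal space is a line: orthogonality to [X_t], with [r <> 0], expresses [cx n] through
    [cy n - cz n], and orthogonality to [X_r] then does the same for [cy n + cz n]. *)
Lemma orthogonal_rot_surface (f g p : R -> R) (r t : R) (n : R3) :
  r <> 0 -> is_derive f r (g r) -> p r = cy n - cz n ->
  lorentz n (dU (rot_surface f) r t) = 0 ->
  lorentz n (dV (rot_surface f) r t) = 0 -> n = rot_normal g p r t.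
Proof.
  intros Hr Hf Hp. rewrite (dU_rot_surface f r t _ Hf), dV_rot_surface.
  destruct n as [[n1 n2] n3]. unfold lorentz, rot_normal, cx, cy, cz in *.
  cbn [fst snd] in *. rewrite Hp. intros HU HV.
  assert (E1 : n1 = t * (n2 - n3)).
  { apply (Rmult_eq_reg_l (2 * r)); lra. }
  assert (E2 : n2 + n3 = - (g r + t ^ 2) * (n2 - n3)).
  { rewrite E1 in HU. lra. }
  f_equal; [f_equal|]; lra.
Qed.

Lemma rot_normal_orthogonal (f g p : R -> R) (r t : R) :
  is_derive f r (g r) ->
  lorentz (rot_normal g p r t) (dU (rot_surface f) r t) = 0 /\
  lorentz (rot_normal g p r t) (dV (rot_surface f) r t) = 0.
Proof.
  intros Hf. rewrite (dU_rot_surface f r t _ Hf), dV_rot_surface.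
  unfold lorentz, rot_normal, cx, cy, cz; cbn [fst snd]. split; field.
Qed.

Lemma lorentz_rot_normal (g p : R -> R) (r t : R) :
  lorentz (rot_normal g p r t) (rot_normal g p r t) = - (g r * (p r * p r)).
Proof. unfold lorentz, rot_normal, cx, cy, cz; cbn [fst snd]. field. Qed.

(** The last hypothesis is the derivative of [g * p ^ 2 = 1] divided by [p]. It makes [N_r] equal to
    [dp / 2] times [X_r], so [X_r] is a principal direction. *)
Lemma dU_rot_normal (g p : R -> R) (r t dg dp : R) :
  is_derive g r dg -> is_derive p r dp ->
  dg * p r + 2 * g r * dp = 0 ->
  dU (rot_normal g p) r t
  = (t * dp, dp * (g r + 1 - t ^ 2) / 2, dp * (g r - 1 - t ^ 2) / 2).
Proof.
  intros Hg Hp E.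
  assert (Eg : ex_derive g r) by now exists dg.
  assert (Ep : ex_derive p r) by now exists dp.
  apply is_derive_unique in Hg as Dg. apply is_derive_unique in Hp as Dp.
  unfold dU, rot_normal, cx, cy, cz; cbn [fst snd].
  f_equal; [f_equal|]; apply is_derive_unique; auto_derive; auto;
    change (fun x => g x) with g; change (fun x => p x) with p;
    rewrite ?Dg, ?Dp; lra.
Qed.

(** For [r <> 0] this is [p r / (2 * r)] times [X_t], the other principal direction. *)
Lemma dV_rot_normal (g p : R -> R) (r t : R) :
  dV (rot_normal g p) r t = (p r, - t * p r, - t * p r).
Proof.
  unfold dV, rot_normal, cx, cy, cz; cbn [fst snd].
  f_equal; [f_equal|]; apply is_derive_unique; auto_derive; trivial; field.
Qed.

Lemma R3_eq_iff (a b c a' b' c' : R) :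
  ((a, b, c) : R3) = (a', b', c') <-> a = a' /\ b = b' /\ c = c'.
Proof. split; [now injection 1 | now intros [-> [-> ->]]]. Qed.

(** The principal curvatures are [- dp / 2] and [- p r / (2 * r)]; eliminating [dp] and [p r] from
    minus their product leaves only [g] and [dg]. The field [N] enters through its derivatives at
    one point, so it may be any field agreeing with [rot_normal] near that point. *)
Lemma gauss_curvature_rot (f g p : R -> R) (N : R -> R -> R3)
    (r t dg dp K : R) :
  0 < r -> is_derive f r (g r) -> is_derive g r dg -> is_derive p r dp ->
  g r * (p r * p r) = 1 -> dg * p r + 2 * g r * dp = 0 ->
  dU N r t = dU (rot_normal g p) r t -> dV N r t = dV (rot_normal g p) r t ->
  gauss_curvature (rot_surface f) N r t K <-> K = dg / (8 * r * g r ^ 2).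
Proof.
  intros Hr Hf Hg Hp E1 E2 EU EV.
  assert (Hp0 : p r <> 0) by (intros H; rewrite H in E1; lra).
  assert (Hg0 : g r <> 0) by (intros H; rewrite H in E1; lra).
  assert (EK : dg / (8 * r * g r ^ 2) = -1 * ((- dp / 2) * (- p r / (2 * r)))).
  { assert (Edg : dg = - 2 * g r * dp / p r).
    { apply (Rmult_eq_reg_r (p r)); [|exact Hp0]. field_simplify; lra. }
    assert (Ep : / (p r * p r) = g r).
    { apply (Rmult_eq_reg_r (p r * p r)); [|nra]. rewrite E1. field. lra. }
    rewrite Edg, <- Ep. field. lra. }
  rewrite EK. unfold gauss_curvature, weingarten.
  rewrite EU, EV, (dU_rot_normal g p r t dg dp), dV_rot_normal,
    (dU_rot_surface f r t (g r)), dV_rot_surface by assumption.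
  unfold lincomb, cx, cy, cz; cbn [fst snd].
  split.
  - intros [a [b [c [d [[HU HV] ->]]]]].
    apply R3_eq_iff in HU, HV.
    destruct HU as [U1 [U2 U3]], HV as [V1 [V2 V3]].
    (* The last two coordinates of [X_t] agree, so subtracting them eliminates [X_t] and isolates
       [a] and [b]. As [b = 0], the product [b * c] vanishes whatever [c] is. *)
    assert (Ea : a = - dp / 2) by lra.
    assert (Eb : b = 0) by lra.
    assert (Ed : d = - p r / (2 * r)).
    { subst b. apply (Rmult_eq_reg_r (2 * r)); [|lra]. field_simplify; lra. }
    rewrite Ea, Eb, Ed. ring.
  - intros ->. exists (- dp / 2), 0, 0, (- p r / (2 * r)).
    split; [|ring]. split; apply R3_eq_iff; repeat split; field; lra.
Qed.

Lemma spacelike_rot_surface (f g : R -> R) (a b : Rbar) :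
  Rbar_le 0 a -> (forall r, ointv a b r -> is_derive f r (g r)) ->
  spacelike (fun r _ => ointv a b r) (rot_surface f) <->
  forall r, ointv a b r -> 0 < g r.
Proof.
  intros Ha Hf.
  assert (E : forall r t x y, ointv a b r ->
    let w := lincomb x (dU (rot_surface f) r t) y (dV (rot_surface f) r t) in
    lorentz w w = 4 * (g r * (x * x) + (r * r) * (y * y))).
  { intros r t x y Hr. rewrite (dU_rot_surface f r t (g r)), dV_rot_surface by auto.
    unfold lincomb, lorentz, cx, cy, cz; cbn [fst snd]. ring. }
  split.
  - intros H r Hr. specialize (H r 0 Hr 1 0). cbv zeta in H.
    rewrite E in H by exact Hr.
    enough (0 < 4 * (g r * (1 * 1) + r * r * (0 * 0))) by lra.
    apply H. injection. lra.
  - intros H r t Hr x y Hxy. cbv zeta. rewrite E by exact Hr.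
    pose proof (ointv_pos a b r Ha Hr) as Hr0. specialize (H r Hr).
    destruct (Req_dec x 0) as [->|Hx].
    + assert (y <> 0) by congruence.
      assert (0 < (r * r) * (y * y)) by (apply Rmult_lt_0_compat; nra). lra.
    + assert (0 < g r * (x * x)) by (apply Rmult_lt_0_compat; nra).
      assert (0 <= (r * r) * (y * y)) by (apply Rmult_le_pos; nra). lra.
Qed.

(** * The translator condition as a differential equation for [f] *)

(** This [p] is the negative root of [g * p ^ 2 = 1], which makes [<N, v> = - p] positive; the
    identity is the relation between [dg] and [dp] under which [X_r] is principal. *)
Lemma is_derive_inv_sqrt (g : R -> R) (r dg : R) :
  0 < g r -> is_derive g r dg ->
  exists dp, is_derive (fun s => - Rpower (g s) (- / 2)) r dp /\
    dg * - Rpower (g r) (- / 2) + 2 * g r * dp = 0.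
Proof.
  intros Hg Hd.
  exists (/ 2 * Rpower (g r) (- / 2 - 1) * dg). split.
  - replace (/ 2 * Rpower (g r) (- / 2 - 1) * dg)
      with (opp (- / 2 * Rpower (g r) (- / 2 - 1) * dg)) by (cbn; ring).
    apply (is_derive_opp (fun s => Rpower (g s) (- / 2))).
    now apply is_derive_Rpower.
  - unfold Rminus. rewrite Rpower_plus, (Rpower_Ropp _ 1), Rpower_1 by exact Hg.
    field. lra.
Qed.

Lemma smooth_on_derive (a b : Rbar) (f : R -> R) (r : R) :
  smooth_on a b f -> ointv a b r ->
  is_derive f r (Derive f r) /\ is_derive (Derive f) r (Derive_n f 2 r).
Proof.
  intros Hf Hr. split; apply Derive_correct.
  - exact (Hf 1%nat r Hr).
  - exact (Hf 2%nat r Hr).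
Qed.

(** [K] and [<N, v>] depend on [r] alone, so all geometric conditions become conditions on [f'] and
    [f'']. *)
Lemma rot_translator_iff (alpha : R) (a b : Rbar) (f : R -> R) :
  rot_translator alpha a b f <->
  Rbar_le 0 a /\ Rbar_lt a b /\ smooth_on a b f /\
  forall r, ointv a b r ->
    0 < Derive f r /\ 0 < Derive_n f 2 r /\
    Rpower (Derive_n f 2 r / (8 * r * Derive f r ^ 2)) alpha
    = Rpower (Derive f r) (- / 2).
Proof.
  set (g := Derive f). set (k := Derive_n f 2).
  set (p := fun s => - Rpower (g s) (- / 2)).
  split.
  - intros [Ha [Hab [Hs [_ [Hsp [N [[_ HN] HK]]]]]]].
    repeat (split; [assumption|]).
    assert (Hd : forall r, ointv a b r ->
      is_derive f r (g r) /\ is_derive g r (k r))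
      by (intros; now apply (smooth_on_derive a b)).
    assert (Hg : forall r, ointv a b r -> 0 < g r).
    { apply (spacelike_rot_surface f g); auto. intros r Hr; apply Hd, Hr. }
    (* The orientation is forced pointwise: [<N, v>] is a value of [Rpower], hence positive, which
       selects the root [p] of [g * p ^ 2 = 1]. *)
    assert (Npt : forall r t, ointv a b r -> N r t = rot_normal g p r t).
    { intros r t Hr. destruct (HN r t Hr) as [N1 [N2 N3]].
      destruct (HK r t Hr) as [K [_ [_ EK]]].
      set (q := fun _ : R => cy (N r t) - cz (N r t)).
      assert (EN : N r t = rot_normal g q r t).
      { apply (orthogonal_rot_surface f g q); try easy.
        - apply Rgt_not_eq, (ointv_pos a b r Ha Hr).
        - apply Hd, Hr. }
      rewrite EN, lorentz_rot_normal in N1.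
      assert (Hq : 0 < - q r).
      { pose proof (Rpower_pos K alpha) as HP. rewrite EK in HP.
        unfold lorentz, cx, cy, cz in HP; cbn [fst snd] in HP.
        unfold q, cy, cz. lra. }
      assert (Eq : q r = p r).
      { pose proof (Rpower_half_neg_sqr (g r) (Hg r Hr)) as Ep.
        pose proof (Rpower_pos (g r) (- / 2)) as Pp. specialize (Hg r Hr).
        unfold p. set (z := Rpower (g r) (- / 2)) in *.
        assert (Ez : (q r + z) * (q r - z) = 0).
        { apply (Rmult_eq_reg_l (g r)); [|lra]. lra. }
        apply Rmult_integral in Ez. lra. }
      rewrite EN. unfold rot_normal. now rewrite Eq. }
    intros r Hr. destruct (Hd r Hr) as [Df Dg]. pose proof (Hg r Hr) as Hgr.
    (* Nothing depends on [t], so the point with [t = 0] suffices. *)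
    destruct (HK r 0 Hr) as [K [HGK [HK0 EK]]].
    destruct (is_derive_inv_sqrt g r (k r) Hgr Dg) as [dp [Dp Ep]].
    pose proof (ointv_pos a b r Ha Hr) as Hr0.
    apply (gauss_curvature_rot f g p N r 0 (k r) dp K) in HGK; auto.
    + subst K. split; [exact Hgr|]. split.
      * replace (k r) with (k r / (8 * r * g r ^ 2) * (8 * r * g r ^ 2))
          by (field; lra).
        apply Rmult_lt_0_compat; [exact HK0|].
        apply Rmult_lt_0_compat; nra.
      * rewrite EK, Npt by exact Hr.
        unfold lorentz, rot_normal, cx, cy, cz, p; cbn [fst snd]. field.
    + unfold p. pose proof (Rpower_half_neg_sqr (g r) Hgr). lra.
    (* The two fields agree for [r] in the open interval, hence only locally in [r], but for every
       [t]. *)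
    + unfold dU. f_equal; [f_equal|]; apply Derive_ext_loc;
        generalize (ointv_open a b r Hr); apply filter_imp;
        intros s Is; now rewrite Npt.
    + unfold dV. f_equal; [f_equal|]; apply Derive_ext; intros s;
        now rewrite Npt.
  - intros [Ha [Hab [Hs H]]].
    assert (Hd : forall r, ointv a b r ->
      is_derive f r (g r) /\ is_derive g r (k r))
      by (intros; now apply (smooth_on_derive a b)).
    repeat (split; [assumption|]). split; [|split].
    + intros r t Hr. destruct (Hd r Hr) as [Df _].
      assert (ex_derive f r) by now exists (g r).
      unfold rot_surface, cx, cy, cz; cbn [fst snd]. split; [|split].
      * apply (differentiable_pt_separable _ (fun s => 2 * s) (fun _ => 0)
          (fun s => s) (fun _ => 0)); [intros; ring | | | |]; auto_derive; auto.
      * apply (differentiable_pt_separable _ (fun s => f s + s) (fun s => - s)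
          (fun _ => 1) (fun s => s ^ 2)); [intros; ring | | | |]; auto_derive; auto.
      * apply (differentiable_pt_separable _ (fun s => f s - s) (fun s => - s)
          (fun _ => 1) (fun s => s ^ 2)); [intros; ring | | | |]; auto_derive; auto.
    + apply (spacelike_rot_surface f g); auto; intros r Hr;
        [apply Hd, Hr | apply H, Hr].
    + exists (rot_normal g p). split; [split|].
      * intros r t Hr. destruct (Hd r Hr) as [_ Dg].
        destruct (H r Hr) as [Hgr _].
        destruct (is_derive_inv_sqrt g r (k r) Hgr Dg) as [dp [Dp _]].
        assert (ex_derive g r) by now exists (k r).
        assert (ex_derive p r) by now exists dp.
        unfold rot_normal, cx, cy, cz; cbn [fst snd]. split; [|split].
        -- apply (differentiable_pt_separable _ p (fun _ => 0)
             (fun s => s) (fun _ => 0)); [intros; ring | | | |]; auto_derive; auto.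
        -- apply (differentiable_pt_separable _ (fun s => (p s - g s * p s) / 2)
             (fun s => - p s / 2) (fun _ => 1) (fun s => s ^ 2));
             [intros; field | | | |]; auto_derive; auto.
        -- apply (differentiable_pt_separable _ (fun s => (- p s - g s * p s) / 2)
             (fun s => - p s / 2) (fun _ => 1) (fun s => s ^ 2));
             [intros; field | | | |]; auto_derive; auto.
      * intros r t Hr. destruct (H r Hr) as [Hgr _]. split.
        -- rewrite lorentz_rot_normal.
           pose proof (Rpower_half_neg_sqr (g r) Hgr). unfold p. lra.
        -- apply rot_normal_orthogonal, Hd, Hr.
      * intros r t Hr. destruct (H r Hr) as [Hgr [Hk EK]].
        destruct (Hd r Hr) as [Df Dg].
        destruct (is_derive_inv_sqrt g r (k r) Hgr Dg) as [dp [Dp Ep]].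
        pose proof (ointv_pos a b r Ha Hr) as Hr0.
        exists (k r / (8 * r * g r ^ 2)). split; [|split].
        -- apply (gauss_curvature_rot f g p _ r t (k r) dp); auto.
           unfold p. pose proof (Rpower_half_neg_sqr (g r) Hgr). lra.
        -- apply Rdiv_lt_0_compat; [exact Hk|]. apply Rmult_lt_0_compat; nra.
        -- rewrite EK. unfold lorentz, rot_normal, cx, cy, cz, p; cbn [fst snd].
           field.
Qed.

Lemma Rpower_inj (x y e : R) :
  0 < x -> 0 < y -> e <> 0 -> Rpower x e = Rpower y e -> x = y.
Proof.
  intros Hx Hy He E. apply (f_equal (fun z => Rpower z (/ e))) in E.
  rewrite !Rpower_mult, Rinv_r, !Rpower_1 in E by assumption. exact E.
Qed.

(** As [alpha <> 0], the equation [K^alpha = g^(-1/2)] can be solved for [K = g^(-1/(2 alpha))], and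
    [g' = 8 r g^2 K]. Conversely the right-hand side is positive since [r > 0], which gives
    [f'' > 0]. *)
Lemma rot_translator_ode (alpha : R) (a b : Rbar) (f : R -> R) :
  alpha <> 0 ->
  rot_translator alpha a b f <->
  Rbar_le 0 a /\ Rbar_lt a b /\ smooth_on a b f /\
  forall r, ointv a b r ->
    0 < Derive f r /\
    Derive_n f 2 r = 8 * r * Rpower (Derive f r) (2 - 1 / (2 * alpha)).
Proof.
  intros Halpha. rewrite rot_translator_iff.
  assert (E : forall r g, 0 < r -> 0 < g ->
    8 * r * Rpower g (2 - 1 / (2 * alpha))
    = 8 * r * g ^ 2 * Rpower g (- (1 / (2 * alpha)))).
  { intros r g Hr Hg. unfold Rminus. rewrite Rpower_plus.
    replace (Rpower g 2) with (g ^ 2); [ring|].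
    symmetry. exact (Rpower_pow 2 g Hg). }
  assert (E' : forall g,
    Rpower (Rpower g (- (1 / (2 * alpha)))) alpha = Rpower g (- / 2)).
  { intros g. rewrite Rpower_mult. f_equal. field. exact Halpha. }
  split; intros [Ha [Hab [Hs H]]]; repeat (split; [assumption|]);
    intros r Hr; pose proof (ointv_pos a b r Ha Hr) as Hr0.
  - destruct (H r Hr) as [Hg [Hk EK]]. split; [exact Hg|].
    assert (0 < 8 * r * Derive f r ^ 2) by (apply Rmult_lt_0_compat; nra).
    rewrite <- E' in EK. apply Rpower_inj in EK; trivial.
    + rewrite E, <- EK by assumption. field. lra.
    + now apply Rdiv_lt_0_compat.
    + apply Rpower_pos.
  - destruct (H r Hr) as [Hg EK]. split; [exact Hg|].
    rewrite EK. split.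
    + apply Rmult_lt_0_compat; [lra | apply Rpower_pos].
    + rewrite E, <- E' by assumption. f_equal. field. lra.
Qed.

(** * Intervals on which the formula gives translators *)

(** The equivalence for the integrand serves twice: existence of a value yields a profile by
    integration, and uniqueness shows that every profile has derivative [g]. *)
Lemma admissible_intro (alpha m : R) (a b : Rbar) (g : R -> R) :
  alpha <> 0 -> Rbar_le 0 a -> Rbar_lt a b ->
  (forall r y, ointv a b r -> is_integrand alpha m r y <-> y = g r) ->
  elementary (ointv a b) g ->
  (forall r, ointv a b r ->
     0 < g r /\ is_derive g r (8 * r * Rpower (g r) (2 - 1 / (2 * alpha)))) ->
  admissible alpha m a b.
Proof.
  intros Halpha Ha Hab Hint Hg Hode. split.
  - destruct (exists_primitive a b g Hab) as [f Hf].
    { intros r Hr. apply (ex_derive_continuous g). eexists. now apply Hode. }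
    exists f. intros r Hr. exists (g r). split; [now apply Hint | now apply Hf].
  - intros f Hprof.
    assert (Hf : forall r, ointv a b r -> is_derive f r (g r)).
    { intros r Hr. destruct (Hprof r Hr) as [y [Hy Df]].
      apply Hint in Hy; trivial. now subst y. }
    apply rot_translator_ode; trivial. repeat (split; [assumption|]). split.
    + apply elementary_smooth. now apply elem_primitive with g.
    + intros r Hr. destruct (Hode r Hr) as [Hpos Dg].
      assert (E : forall s, ointv a b s -> Derive f s = g s)
        by (intros; now apply is_derive_unique, Hf).
      rewrite E by exact Hr. split; [exact Hpos|].
      rewrite <- (is_derive_unique _ _ _ Dg). apply Derive_ext_loc.
      generalize (ointv_open a b r Hr). now apply filter_imp.
Qed.

Lemma admissible_half (m : R) (a b : Rbar) :
  0 < m -> Rbar_le 0 a -> Rbar_lt a b -> admissible (1 / 2) m a b.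
Proof.
  intros Hm Ha Hab.
  apply admissible_intro with (fun t => m * exp (4 * t ^ 2)); trivial.
  - lra.
  - intros r y _. unfold is_integrand. lra.
  - apply elem_mult; [constructor|]. apply elem_exp.
    apply elem_mult; [constructor|]. cbn.
    repeat apply elem_mult; constructor.
  - intros r Hr.
    assert (0 < m * exp (4 * r ^ 2))
      by (apply Rmult_lt_0_compat; [exact Hm | apply exp_pos]).
    split; [assumption|].
    (* For this [alpha] the equation is linear: [g' = 8 r g]. *)
    replace (2 - 1 / (2 * (1 / 2))) with 1 by field.
    rewrite Rpower_1 by assumption. auto_derive; trivial. cbn. ring.
Qed.

(** On a positive base the integer clause agrees with [Rpower], so the power is single-valued
    there. *)
Lemma is_power_pos (x e y : R) : 0 < x -> is_power x e y <-> y = Rpower x e.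
Proof.
  intros Hx. unfold is_power. split.
  - intros [[_ H]|[[H _]|[n [-> [_ H]]]]]; trivial; [lra|].
    now rewrite <- powerRZ_Rpower.
  - intros ->. now left.
Qed.

Lemma is_derive_base (c m r : R) : is_derive (fun t => c * t ^ 2 + m) r (2 * c * r).
Proof. auto_derive; trivial. ring. Qed.

Lemma admissible_base (alpha m : R) (a b : Rbar) :
  alpha <> 0 -> alpha <> 1 / 2 -> Rbar_le 0 a -> Rbar_lt a b ->
  (forall r, ointv a b r -> 0 < 2 * (1 - 2 * alpha) / alpha * r ^ 2 + m) ->
  admissible alpha m a b.
Proof.
  intros H0 H12 Ha Hab Hbase.
  set (c := 2 * (1 - 2 * alpha) / alpha) in Hbase.
  set (e := 2 * alpha / (1 - 2 * alpha)).
  apply admissible_intro with (fun t => Rpower (c * t ^ 2 + m) e); trivial.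
  - intros r y Hr. unfold is_integrand. fold c e.
    rewrite (is_power_pos _ e y (Hbase r Hr)). lra.
  - apply elem_Rpower; [|exact Hbase]. apply elem_plus; [|constructor].
    cbn. repeat apply elem_mult; constructor.
  - intros r Hr. split; [apply Rpower_pos|]. rewrite Rpower_mult.
    (* With [B] the base, both sides equal [8 r B^(e - 1)], because [e / (2 alpha) = e + 1] and
       [c * e = 4]. *)
    replace (e * (2 - 1 / (2 * alpha))) with (e - 1)
      by (unfold e; field; lra).
    replace (8 * r * Rpower (c * r ^ 2 + m) (e - 1))
      with (e * Rpower (c * r ^ 2 + m) (e - 1) * (2 * c * r))
      by (unfold e, c; field; lra).
    apply (is_derive_Rpower (fun t => c * t ^ 2 + m));
      [now apply Hbase | apply is_derive_base].
Qed.

Lemma admissible_pos (alpha m : R) (a b : Rbar) (r : R) :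
  admissible alpha m a b -> ointv a b r -> 0 < r.
Proof.
  intros [[f Hf] Htr] Hr. destruct (Htr f Hf) as [Ha _].
  now apply (ointv_pos a b).
Qed.

(* Where the base B = c r^2 + m is negative, the exponent e is an integer and
   f' = B^e; as c e = 4, this gives f'' = 8 r f' / B, so f' and f'' cannot
   both be positive. *)
Lemma base_pos_of_admissible (alpha m : R) (a b : Rbar) (r : R) :
  alpha <> 0 -> alpha <> 1 / 2 -> admissible alpha m a b -> ointv a b r ->
  0 < 2 * (1 - 2 * alpha) / alpha * r ^ 2 + m.
Proof.
  intros H0 H12 [[f Hf] Htr] Hr. pose proof (Htr f Hf) as Tf.
  apply rot_translator_iff in Tf. destruct Tf as [Ha [_ [_ Hpos]]].
  destruct (Hpos r Hr) as [Hg [Hk _]]. pose proof (ointv_pos a b r Ha Hr) as Hr0.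
  set (c := 2 * (1 - 2 * alpha) / alpha) in *.
  assert (Hprof : forall s, ointv a b s ->
    is_power (c * s ^ 2 + m) (2 * alpha / (1 - 2 * alpha)) (Derive f s)).
  { intros s Hs. destruct (Hf s Hs) as [y [[[H _]|[_ Hy]] Df]]; [lra|].
    now rewrite (is_derive_unique f s y Df). }
  set (e := 2 * alpha / (1 - 2 * alpha)) in *.
  destruct (Rtotal_order (c * r ^ 2 + m) 0) as [Hneg|[Hz|H]]; [exfalso| |exact H].
  (* A zero base would give [f' = 0], against [0 < f']. *)
  2:{ destruct (Hprof r Hr) as [[H _]|[[_ [_ H]]|[n [_ [H _]]]]]; lra. }
  assert (Hn : exists n, e = IZR n).
  { destruct (Hprof r Hr) as [[H _]|[[H _]|[n [H _]]]]; [lra|lra|]. now exists n. }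
  (* Near [r] the base [B] stays negative and [B^n = (-1)^n (-B)^n], which brings back a power of a
     positive base that can be differentiated. *)
  destruct Hn as [n En]. set (sigma := powerRZ (-1) n).
  assert (Hloc : locally r (fun s =>
    sigma * Rpower (- c * s ^ 2 + - m) e = Derive f s)).
  { assert (Hcont : locally r (fun s => c * s ^ 2 + m < 0)).
    { assert (Hc : continuous (fun t => c * t ^ 2 + m) r).
      { apply (ex_derive_continuous (fun t => c * t ^ 2 + m)).
        eexists. apply is_derive_base. }
      apply (Hc (fun y => y < 0)). now apply open_lt. }
    generalize (filter_and _ _ Hcont (ointv_open a b r Hr)).
    apply filter_imp. intros s [Hs Is].
    destruct (Hprof s Is) as [[H _]|[[H _]|[n' [En' [_ ->]]]]]; [lra|lra|].
    assert (n' = n) as -> by (apply eq_IZR; congruence).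
    rewrite En, <- powerRZ_Rpower by lra. unfold sigma.
    rewrite <- powerRZ_mult. f_equal. ring. }
  assert (Eg : Derive f r = sigma * Rpower (- c * r ^ 2 + - m) e).
  { symmetry. exact (locally_singleton _ _ Hloc). }
  assert (Ek : Derive_n f 2 r
    = - (8 * r) * (sigma * Rpower (- c * r ^ 2 + - m) (e - 1))).
  { change (Derive_n f 2 r) with (Derive (Derive f) r). apply is_derive_unique.
    apply (is_derive_ext_loc _ _ _ _ Hloc).
    replace (- (8 * r) * (sigma * Rpower (- c * r ^ 2 + - m) (e - 1)))
      with (sigma * (e * Rpower (- c * r ^ 2 + - m) (e - 1) * (2 * - c * r)))
      by (unfold e, c; field; lra).
    apply (is_derive_scal (fun s => Rpower (- c * s ^ 2 + - m) e)).
    apply (is_derive_Rpower (fun s => - c * s ^ 2 + - m));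
      [lra | apply is_derive_base]. }
  (* Positivity of [f'] forces [sigma > 0], and then [Ek] makes [f''] negative. *)
  assert (0 < sigma).
  { pose proof (Rpower_pos (- c * r ^ 2 + - m) e). nra. }
  pose proof (Rpower_pos (- c * r ^ 2 + - m) (e - 1)).
  assert (0 < 8 * r * (sigma * Rpower (- c * r ^ 2 + - m) (e - 1)))
    by (repeat apply Rmult_lt_0_compat; lra).
  lra.
Qed.

(** * Every translator is given by the formula *)

(** The constant [m] is the value of the first integral at an interior point [r0]. For
    [alpha = 1 / 2] it is [f'] times an exponential, hence positive. *)
Lemma profile_of_translator (alpha : R) (a b : Rbar) (f : R -> R) :
  alpha <> 0 -> rot_translator alpha a b f ->
  exists m : R, (alpha = 1 / 2 -> 0 < m) /\ is_profile alpha m a b f.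
Proof.
  intros H0 Tf. apply rot_translator_ode in Tf; [|exact H0].
  destruct Tf as [Ha [Hab [Hs Hode]]].
  destruct (ointv_nonempty a b Hab) as [r0 Hr0].
  destruct (Req_dec alpha (1 / 2)) as [->|H12].
  - set (h := fun r => Derive f r * exp (- 4 * r ^ 2)).
    assert (Hh : forall r, ointv a b r -> is_derive h r 0).
    { intros r Hr. destruct (smooth_on_derive a b f r Hs Hr) as [_ D].
      destruct (Hode r Hr) as [Hg E]. rewrite E in D.
      replace (2 - 1 / (2 * (1 / 2))) with 1 in D by field.
      rewrite Rpower_1 in D by exact Hg.
      assert (ex_derive (Derive f) r) by now eexists; apply D.
      apply is_derive_unique in D.
      unfold h. auto_derive; [easy|].
      change (fun x => Derive (fun y => f y) x) with (Derive f).
      change (fun x => Derive f x) with (Derive f).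
      change (fun x => f x) with f. rewrite D. ring. }
    exists (h r0). split.
    + intros _. apply Rmult_lt_0_compat; [now apply Hode | apply exp_pos].
    + intros r Hr. exists (Derive f r). split.
      * left. split; [reflexivity|].
        rewrite (derive_zero_constant a b h Hh r0 r Hr0 Hr). unfold h.
        rewrite Rmult_assoc, <- exp_plus.
        replace (- 4 * r ^ 2 + 4 * r ^ 2) with 0 by ring.
        rewrite exp_0. ring.
      * now apply (smooth_on_derive a b).
  - set (c := 2 * (1 - 2 * alpha) / alpha).
    set (beta := (1 - 2 * alpha) / (2 * alpha)).
    set (h := fun r => Rpower (Derive f r) beta + - c * r ^ 2).
    assert (Hh : forall r, ointv a b r -> is_derive h r 0).
    { intros r Hr. destruct (smooth_on_derive a b f r Hs Hr) as [_ D].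
      destruct (Hode r Hr) as [Hg E]. rewrite E in D.
      replace 0 with (beta * Rpower (Derive f r) (beta - 1)
        * (8 * r * Rpower (Derive f r) (2 - 1 / (2 * alpha))) + 2 * - c * r).
      - apply (is_derive_plus (fun s => Rpower (Derive f s) beta)
          (fun s => - c * s ^ 2)).
        + now apply (is_derive_Rpower (Derive f)).
        + auto_derive; trivial. ring.
      (* The exponents [beta - 1] and [2 - 1 / (2 alpha)] are opposite, so the powers cancel and
         leave [8 * beta * r = 2 * c * r]. *)
      - replace (2 - 1 / (2 * alpha)) with (- (beta - 1))
          by (unfold beta; field; lra).
        rewrite Rpower_Ropp. unfold c, beta. field.
        split; [lra|]. apply Rgt_not_eq, Rpower_pos. }
    exists (h r0). split; [easy|].
    intros r Hr. exists (Derive f r). split.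
    + right. split; [exact H12|].
      rewrite (derive_zero_constant a b h Hh r0 r Hr0 Hr). fold c.
      replace (c * r ^ 2 + h r) with (Rpower (Derive f r) beta)
        by (unfold h; ring).
      (* The base is [f'^beta], positive, and the exponent of the formula is [1 / beta], so the
         power recovers [f']. *)
      apply is_power_pos; [apply Rpower_pos|]. rewrite Rpower_mult.
      replace (beta * (2 * alpha / (1 - 2 * alpha))) with 1
        by (unfold beta; field; lra).
      symmetry. apply Rpower_1. now apply Hode.
    + now apply (smooth_on_derive a b).
Qed.

(** * Maximal domains *)

(** An admissible interval has a profile, hence a translator, and [rot_translator] includes [a < b];
    so there is a point at which to derive a contradiction. *)
Lemma empty_domain_intro (alpha m : R) :
  (forall a b r, admissible alpha m a b -> ~ ointv a b r) ->
  empty_domain alpha m.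
Proof.
  intros H a b Hadm. pose proof Hadm as [[f Hf] Htr].
  destruct (Htr f Hf) as [_ [Hab _]].
  destruct (ointv_nonempty a b Hab) as [r Hr]. exact (H a b r Hadm Hr).
Qed.

Lemma sqrt_lt_iff (x r : R) : 0 <= x -> 0 < r -> sqrt x < r <-> x < r ^ 2.
Proof.
  intros Hx Hr. pose proof (sqrt_pos x). pose proof (sqrt_sqrt x Hx).
  split; intros; nra.
Qed.

Lemma lt_sqrt_iff (x r : R) : 0 <= x -> 0 < r -> r < sqrt x <-> r ^ 2 < x.
Proof.
  intros Hx Hr. pose proof (sqrt_pos x). pose proof (sqrt_sqrt x Hx).
  split; intros; nra.
Qed.

Theorem theorem3p11 (alpha : R) (halpha : alpha <> 0) :
  (forall (a b : Rbar) (f : R -> R), rot_translator alpha a b f ->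
     exists m : R, (alpha = 1 / 2 -> 0 < m) /\ is_profile alpha m a b f) /\
  (alpha = 1 / 2 ->
     (forall m : R, 0 < m -> maximal_domain alpha m 0 p_infty) /\
     (forall m : R, m <= 0 -> empty_domain alpha m)) /\
  (0 < alpha < 1 / 2 ->
     (forall m : R, 0 <= m -> maximal_domain alpha m 0 p_infty) /\
     (forall m : R, m < 0 ->
        maximal_domain alpha m (sqrt (alpha / (2 * (2 * alpha - 1)) * m)) p_infty)) /\
  (~ (0 <= alpha <= 1 / 2) ->
     (forall m : R, 0 < m ->
        maximal_domain alpha m 0 (sqrt (alpha / (2 * (2 * alpha - 1)) * m))) /\
     (forall m : R, m <= 0 -> empty_domain alpha m)).
Proof.
  (* With the coefficient of [r ^ 2] factored out, the base compares [r ^ 2] with the radicand of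
     the endpoint. *)
  assert (Ebase : forall m r, alpha <> 1 / 2 ->
    2 * (1 - 2 * alpha) / alpha * r ^ 2 + m
    = 2 * (1 - 2 * alpha) / alpha
      * (r ^ 2 - alpha / (2 * (2 * alpha - 1)) * m)) by (intros; field; lra).
  split; [|split; [|split]].
  - intros a b f. now apply profile_of_translator.
  - intros H12. split; intros m Hm.
    + split.
      * rewrite H12. apply admissible_half; [exact Hm | apply Rle_refl | exact I].
      * intros a b Hadm r Hr. split; [|exact I].
        exact (admissible_pos alpha m a b r Hadm Hr).
    + apply empty_domain_intro. intros a b r [[f Hf] Htr] Hr.
      destruct (proj1 (rot_translator_iff _ _ _ _) (Htr f Hf)) as [_ [_ [_ H]]].
      destruct (H r Hr) as [Hg _].
      destruct (Hf r Hr) as [y [[[_ Hy]|[? _]] Df]]; [|lra].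
      rewrite (is_derive_unique f r y Df), Hy in Hg.
      pose proof (exp_pos (4 * r ^ 2)). nra.
  - intros Ha. assert (H12 : alpha <> 1 / 2) by lra.
    (* The coefficient of [r ^ 2] is positive: for [m >= 0] the base is positive at every [r > 0],
       for [m < 0] exactly beyond the square root. *)
    assert (Hc : 0 < 2 * (1 - 2 * alpha) / alpha)
      by (apply Rdiv_lt_0_compat; lra).
    assert (Hx : forall m, m < 0 -> 0 <= alpha / (2 * (2 * alpha - 1)) * m).
    { intros m Hm. replace (alpha / (2 * (2 * alpha - 1)) * m)
        with (- m / (2 * (1 - 2 * alpha) / alpha)) by (field; lra).
      apply Rlt_le, Rdiv_lt_0_compat; lra. }
    split; intros m Hm; split.
    + apply admissible_base; trivial; [apply Rle_refl | exact I |].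
      intros r [Hr _]. cbn in Hr.
      assert (0 < 2 * (1 - 2 * alpha) / alpha * r ^ 2)
        by (apply Rmult_lt_0_compat; nra). lra.
    + intros a b Hadm r Hr. split; [|exact I].
      exact (admissible_pos alpha m a b r Hadm Hr).
    + apply admissible_base; trivial; [apply sqrt_pos | exact I |].
      intros r [Hr _]. cbn in Hr. rewrite Ebase by exact H12.
      pose proof (sqrt_pos (alpha / (2 * (2 * alpha - 1)) * m)).
      apply sqrt_lt_iff in Hr; [|now apply Hx|lra].
      apply Rmult_lt_0_compat; lra.
    + intros a b Hadm r Hr. split; [|exact I].
      apply sqrt_lt_iff;
        [now apply Hx | exact (admissible_pos alpha m a b r Hadm Hr)|].
      pose proof (base_pos_of_admissible alpha m a b r halpha H12 Hadm Hr) as Hb.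
      rewrite Ebase in Hb by exact H12. nra.
  - intros Ha. assert (H12 : alpha <> 1 / 2) by lra.
    (* The coefficient is negative for [alpha < 0] and for [alpha > 1 / 2]: the base is positive
       exactly below the square root if [m > 0], and nowhere if [m <= 0]. *)
    assert (Hc : 2 * (1 - 2 * alpha) / alpha < 0).
    { destruct (Rlt_dec alpha 0) as [H|H].
      - apply Rdiv_pos_neg; lra.
      - apply Rdiv_neg_pos; lra. }
    split; intros m Hm.
    + assert (Hx : 0 < alpha / (2 * (2 * alpha - 1)) * m).
      { replace (alpha / (2 * (2 * alpha - 1)) * m)
          with (m / - (2 * (1 - 2 * alpha) / alpha)) by (field; lra).
        apply Rdiv_lt_0_compat; lra. }
      split.
      * apply admissible_base; trivial;
          [apply Rle_refl | exact (sqrt_lt_R0 _ Hx) |].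
        intros r [Hr0 Hr]. cbn in Hr0, Hr. rewrite Ebase by exact H12.
        apply lt_sqrt_iff in Hr; [|lra|exact Hr0]. nra.
      * intros a b Hadm r Hr.
        pose proof (admissible_pos alpha m a b r Hadm Hr) as Hr0.
        split; [exact Hr0|]. apply lt_sqrt_iff; [lra|exact Hr0|].
        pose proof (base_pos_of_admissible alpha m a b r halpha H12 Hadm Hr) as Hb.
        rewrite Ebase in Hb by exact H12. nra.
    + apply empty_domain_intro. intros a b r Hadm Hr.
      pose proof (base_pos_of_admissible alpha m a b r halpha H12 Hadm Hr). nra.
Qed.
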